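(* Let $\widetilde{\mathfrak A}$ and $\widetilde\Omega$ be open subsets of $\mathbb R^d$, with $\widetilde{\mathfrak A}$ connected and $\widetilde\Omega$ convex, and let $F:\widetilde{\mathfrak A}\to\widetilde\Omega$ be a $\mathcal C^2$ homeomorphism with $\det F'\neq0$ on $\widetilde{\mathfrak A}$. Let $L_*,L_0\in\widetilde\Omega$ and let $A_*\in\widetilde{\mathfrak A}$ be the unique solution of $F(A_* )=L_*$. Then for every $\varepsilon>0$ there exist $\sigma_0>0$ and an integer $N_0\ge1$ such that for every integer $n>N_0$ and every $\sigma\in(0,\sigma_0)$, the continuation scheme described in the context with parameters $n$ and $\sigma$ is well defined, the Newton method terminates at each of its $n$ steps, and the final output satisfies $|A^{(n)}_{fin}-A_*|<\varepsilon$.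
   Context: Newton method for solving $F(A)=\widehat L$ with tolerance $\sigma>0$ and starting point $A_{st}$: set $A^{(0)}=A_{st}$ and $A^{(j+1)}=A^{(j)}-F'(A^{(j)})^{-1}\big(F(A^{(j)})-\widehat L\big)$, $j\ge0$; the process stops at the first $j$ with $|F(A^{(j)})-\widehat L|<\sigma$, and $A_{fin}:=A^{(j)}$ is its output. Continuation scheme with parameters $n\ge1$ and $\sigma>0$: let $A_0=F^{-1}(L_0)$ and $L_k=((n-k)L_0+kL_* )/n$ for $k=0,\dots,n$. For $k=1,\dots,n$, run the Newton method for $F(A)=L_k$ with tolerance $\sigma$ and starting point $A^{(k)}_{st}=A^{(k-1)}_{fin}$ (with $A^{(0)}_{fin}:=A_0$), and let $A^{(k)}_{fin}$ be its output. The final output is $A^{(n)}_{fin}$. *)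

(* Defs.v *)
From HB Require Import structures.
From mathcomp Require Import all_boot all_order all_algebra.
From mathcomp Require Import all_classical all_reals all_analysis.
Set Implicit Arguments. Unset Strict Implicit. Unset Printing Implicit Defensive.
Import Order.TTheory GRing.Theory Num.Theory.
Import numFieldNormedType.Exports.
Local Open Scope classical_set_scope.
Local Open Scope ring_scope.

(* Points of R^d are row vectors 'rV[R]_d; F'(x) is the Jacobian matrix
   'J F x (row-vector convention: 'd F x v = v *m 'J F x). *)

Definition unitv (R : realType) (d : nat) (i : 'I_d) : 'rV[R]_d := delta_mx 0 i.

Definition C2_on (R : realType) (d : nat) (U : set 'rV[R]_d)
    (F : 'rV[R]_d -> 'rV[R]_d) :=
  [/\ (forall x, U x -> differentiable F x),
      (forall i x, U x -> differentiable ('D_(unitv R i) F) x) &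
      (forall i j x, U x ->
          {for x, continuous ('D_(unitv R j) ('D_(unitv R i) F))})].

Definition homeo_on (R : realType) (d : nat) (U V : set 'rV[R]_d)
    (F : 'rV[R]_d -> 'rV[R]_d) :=
  [/\ (forall x, U x -> V (F x)),
      {within U, continuous F} &
      exists G : 'rV[R]_d -> 'rV[R]_d,
        [/\ (forall y, V y -> U (G y) /\ F (G y) = y),
            (forall x, U x -> G (F x) = x) &
            {within V, continuous G}]].

Definition newton_iter (R : realType) (d : nat) (F : 'rV[R]_d -> 'rV[R]_d)
    (L Ast : 'rV[R]_d) : nat -> 'rV[R]_d :=
  fix it j := match j with
  | 0%N => Ast
  | j'.+1 => it j' - (F (it j') - L) *m invmx ('J F (it j'))
  end.

Definition newton_run (R : realType) (d : nat) (U : set 'rV[R]_d)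
    (F : 'rV[R]_d -> 'rV[R]_d) (L : 'rV[R]_d) (sigma : R)
    (Ast Afin : 'rV[R]_d) :=
  exists m : nat,
    [/\ (forall j, (j < m)%N ->
            [/\ U (newton_iter F L Ast j),
                'J F (newton_iter F L Ast j) \in unitmx &
                sigma <= `|F (newton_iter F L Ast j) - L| ]),
        U (newton_iter F L Ast m),
        `|F (newton_iter F L Ast m) - L| < sigma &
        Afin = newton_iter F L Ast m].

Definition cont_target (R : realType) (d : nat) (n k : nat) (L0 Ls : 'rV[R]_d)
    : 'rV[R]_d :=
  (n%:R)^-1 *: (((n - k)%N)%:R *: L0 + k%:R *: Ls).

Definition continuation_run (R : realType) (d : nat) (U : set 'rV[R]_d)
    (F : 'rV[R]_d -> 'rV[R]_d) (L0 Ls A0 : 'rV[R]_d) (n : nat) (sigma : R)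
    (Aout : 'rV[R]_d) :=
  exists Afin : nat -> 'rV[R]_d,
    [/\ Afin 0%N = A0,
        (forall k, (1 <= k <= n)%N ->
            newton_run U F (cont_target n k L0 Ls) sigma
                       (Afin k.-1) (Afin k)) &
        Aout = Afin n].

(* Main.v *)
Require Import Defs.
From HB Require Import structures.
From mathcomp Require Import all_boot all_order all_algebra.
From mathcomp Require Import all_classical all_reals all_analysis.
From mathcomp Require Import ring lra.
Import Order.TTheory GRing.Theory Num.Theory.
Import numFieldNormedType.Exports.
Local Open Scope classical_set_scope.
Local Open Scope ring_scope.

(* Let G be the inverse of F. Near each point of the domain the Newton map for
   F(A) = F(a) is a contraction by 1/2 towards a, and by compactness of the
   segment K = [L0, Ls] this holds on balls of one radius r around all the points
   a = G L with L in K. Since G is uniformly continuous near K, for small sigma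
   and large n both the stopping error |A_fin - G L_k| and the distance
   |G L_k - G L_(k+1)| stay below min(r/2, eps), so every output is again an
   admissible starting point for the next target. *)

(** * Maximum norm and mean value inequality *)

Lemma le_normr_coord (R : realType) (m n : nat) (A : 'M[R]_(m, n)) i j :
  `|A i j| <= `|A|.
Proof.
rewrite [leRHS]/Num.Def.normr /= mx_normrE.
by apply/bigmax_geP; right => /=; exists (i, j).
Qed.

Lemma normr_mx_le (R : realType) (m n : nat) (A : 'M[R]_(m, n)) (c : R) :
  0 <= c -> (forall i j, `|A i j| <= c) -> `|A| <= c.
Proof.
move=> c0 Ac; rewrite [leLHS]/Num.Def.normr /= mx_normrE.
by apply: bigmax_le => // -[i j] _; exact: Ac.
Qed.

(** The norm is the largest absolute entry, not an operator norm; an entry of the product is a sum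
    of [n] terms, whence the factor [n]. *)
Lemma normr_mulmx_le (R : realType) (m n p : nat)
    (A : 'M[R]_(m, n)) (B : 'M[R]_(n, p)) :
  `|A *m B| <= n%:R * (`|A| * `|B|).
Proof.
apply: normr_mx_le => [|i j]; first by rewrite !mulr_ge0.
rewrite mxE (le_trans (ler_norm_sum _ _ _))//.
rewrite (le_trans (ler_sum _ (G := fun=> `|A| * `|B|) _))//.
  by move=> k _; rewrite normrM ler_pM// le_normr_coord.
by rewrite sumr_const card_ord mulr_natl.
Qed.

(** Chain rule for a coordinate map after [f] after an affine path; it feeds the scalar mean value
    theorem. *)
Lemma is_derive_coord_line (R : realType) (V : normedModType R) (n : nat)
    (f : V -> 'rV[R]_n) (x v : V) (j : 'I_n) (t : R) :
  differentiable f (x + t *: v) ->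
  is_derive t 1 (fun s : R => f (x + s *: v) 0 j : R)
    (('d f (x + t *: v) v) 0 j).
Proof.
move=> df; pose p (s : R) : V := x + s *: v.
pose co (y : 'rV[R]_n) : R := y 0 j.
have dp : is_diff t p ( *:%R ^~ v).
  have d1 : is_diff t (cst x : R -> V) 0 := is_diff_cst x t.
  have d2 : is_diff t ( *:%R ^~ v : R -> V) ( *:%R ^~ v) := is_diff_scalel t v.
  by have := is_diffD d1 d2; rewrite add0r.
have pd : differentiable p t by exact: ex_diff.
have dpE : 'd p t = *:%R^~ v :> (R -> V) by exact: diff_val.
have fpd : differentiable (f \o p) t by exact: differentiable_comp.
have lin : linear co by move=> a y z; rewrite /co !mxE.
pose M := GRing.isLinear.Build _ _ _ _ _ lin.
pose l : {linear 'rV[R]_n -> R} := HB.pack co M.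
have cod y : differentiable co y by exact: differentiable_coord.
have dcoE y : 'd co y = co :> (_ -> _).
  by rewrite -[co]/(l : _ -> _) diff_lin//; exact: coord_continuous.
have cofpd : differentiable (co \o (f \o p)) t by exact: differentiable_comp.
apply: DeriveDef; first exact/diff_derivable.
by rewrite (deriveE _ cofpd) diff_comp//= diff_comp//= dpE scale1r dcoE.
Qed.

(** Vector-valued maps have no mean value equality, but under the maximum norm the scalar theorem
    applies to each coordinate with its own [t]. The free vector [w] allows comparison with a
    derivative frozen at another point. *)
Lemma mean_value_le (R : realType) (V : normedModType R) (n : nat)
    (f : V -> 'rV[R]_n) (x v : V) (w : 'rV[R]_n) (c : R) :
  (forall t : R, 0 <= t <= 1 -> differentiable f (x + t *: v)) ->
  (forall t : R, 0 <= t <= 1 -> `|'d f (x + t *: v) v - w| <= c) ->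
  `|f (x + v) - f x - w| <= c.
Proof.
move=> df dfc.
have c0 : 0 <= c by apply: le_trans (dfc 0 _); rewrite ?lexx ?ler01.
apply: normr_mx_le => // i j; rewrite (ord1 i).
pose g (t : R) : R := f (x + t *: v) 0 j.
have dg (t : R) : t \in `[0, 1]%R ->
    is_derive t 1 g (('d f (x + t *: v) v) 0 j).
  by rewrite in_itv => /df; exact: is_derive_coord_line.
have dgo (t : R) : t \in `]0, 1[%R ->
    is_derive t 1 g (('d f (x + t *: v) v) 0 j).
  by move=> t01; apply: dg; exact: subset_itv_oo_cc.
have cg : {within `[0, 1], continuous g}.
  by apply: derivable_within_continuous => t /dg dgt; exact: ex_derive.
have [t] := MVT_segment ler01 dgo cg.
rewrite in_itv /= => t01; rewrite /g scale1r scale0r addr0 subr0 mulr1 => E.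
apply: le_trans (dfc t t01).
apply: le_trans (le_normr_coord _ _ _ ('d f (x + t *: v) v - w) 0 j).
by rewrite !mxE E.
Qed.

(** Locally one [r] works for all [y] near [x]; since [P] passes to smaller radii, it holds jointly
    for [y] near [x] and [r] near [0^'+], which is what the covering form of compactness takes. *)
Lemma compact_uniform_radius (R : realType) (V : normedModType R) (K : set V)
    (P : V -> R -> Prop) :
  compact K ->
  (forall x r s, s <= r -> P x r -> P x s) ->
  (forall x, K x -> exists2 r, 0 < r & forall y, `|y - x| < r -> P y r) ->
  exists2 r, 0 < r & forall x, K x -> P x r.
Proof.
move=> /compact_near_coveringP cK Pmono locP.
have loc x : K x -> \forall y \near x & r \near 0^'+, P y r.
  move=> /locP[r r0 Pr]; near=> y s => /=; apply: (Pmono _ r).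
    by near: s; exact: nbhs_right_le.
  apply: Pr; rewrite distrC; near: y.
  by apply/nbhs_normP; exists r.
have Kr := cK R 0^'+ (fun r x => P x r) _ loc.
have /filter_ex[r [r0 Pr]] : \forall r \near 0^'+, 0 < r /\ K `<=` P^~ r.
  by near=> r; split; near: r; [exact: nbhs_right_gt|exact: Kr].
by exists r.
Unshelve. all: by end_near. Qed.

(** * Local contraction of the Newton map *)

Lemma jacobian_near (R : realType) (m n : nat) (F : 'rV[R]_m -> 'rV[R]_n)
    (a : 'rV[R]_m) (c : R) :
  (\forall x \near a, differentiable F x) ->
  (forall i, {for a, continuous ('D_(unitv R i) F)}) ->
  0 < c -> \forall x \near a, `|'J F x - 'J F a| <= c.
Proof.
move=> dF cD c0.
have JE x i j : differentiable F x -> 'J F x i j = 'D_(unitv R i) F x 0 j.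
  by move=> dFx; rewrite deriveEjacobian// /unitv -rowE [RHS]mxE.
move: (jacobian F) JE => J JE.
pose close (ij : 'I_m * 'I_n) (x : 'rV[R]_m) : Prop :=
  `|'D_(unitv R ij.1) F x 0 ij.2 - 'D_(unitv R ij.1) F a 0 ij.2| <= c.
have near_close : \forall x \near a, forall ij, close ij x.
  apply: (@filter_forall _ _ close (nbhs a)) => -[i j]; rewrite /close /=.
  have cDij : {for a, continuous (fun x => 'D_(unitv R i) F x 0 j : R)}.
    apply: (continuous_comp (cD i) (g := fun y : 'rV[R]_n => y 0 j : R)).
    exact: coord_continuous.
  near=> x; rewrite distrC ltW//; near: x.
  by move/cvgrPdist_lt : cDij; exact.
have dFa := nbhs_singleton dF.
apply: (filterS2 _ _ near_close dF) => x closex dFx.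
apply: normr_mx_le => [|i j]; first exact: ltW.
by rewrite mxE [X in _ + X]mxE !JE//; exact: (closex (i, j)).
Unshelve. all: by end_near. Qed.

Lemma normr_segment_lt (R : realType) (V : normedModType R) (a x y : V)
    (r t : R) :
  `|x - a| < r -> `|y - a| < r -> 0 <= t <= 1 -> `|y + t *: (x - y) - a| < r.
Proof.
move=> xr yr /andP[t0 t1].
have -> : y + t *: (x - y) - a = (1 - t) *: (y - a) + t *: (x - a).
  rewrite -[x - y](subrKA a) addrAC -[a - y]opprB scalerBr scalerBl scale1r.
  by rewrite [t *: _ - _]addrC addrA.
apply: le_lt_trans (ler_normD _ _) _; rewrite !normrZ.
rewrite (ger0_norm t0) ger0_norm ?subr_ge0//.
set p := `|y - a| in yr *; set q := `|x - a| in xr *.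
have [->|t0'] := eqVneq t 0; first by rewrite subr0 mul1r mul0r addr0.
have tp : 0 < t by rewrite lt_neqAle eq_sym t0'.
nra.
Qed.

(* Multiplying the new error by ['J F x] turns it into the Taylor remainder of
   [F], which is at most [2 c |x - y|] near [a] for any prescribed [c > 0]. *)
Lemma newton_step_near (R : realType) (d : nat) (F : 'rV[R]_d -> 'rV[R]_d)
    (a : 'rV[R]_d) :
  (\forall x \near a, differentiable F x) ->
  (forall i, {for a, continuous ('D_(unitv R i) F)}) ->
  (\forall x \near a, 'J F x \in unitmx) ->
  exists2 r, 0 < r & forall x y, `|x - a| < r -> `|y - a| < r ->
    `|x - (F x - F y) *m invmx ('J F x) - y| <= 2^-1 * `|x - y|.
Proof.
move=> dF cD uJ.
(* [k] bounds multiplication by the inverse Jacobian at [a], and [c] makes [k * c <= 1/5], the [+ 1]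
   covering [k = 0]. Then [E <= k * (2 * c * D + c * E)] gives [4/5 * E <= 2/5 * D]. *)
pose k : R := d%:R * `|invmx ('J F a)|.
have k0 : 0 <= k by rewrite mulr_ge0.
pose c : R := (5 * (k + 1))^-1.
have c0 : 0 < c by rewrite invr_gt0; nra.
have kc : 5 * (k * c) <= 1.
  by rewrite mulrCA mulrA ler_pdivrMr ?mul1r; nra.
have arith (E D : R) : 0 <= E -> 0 <= D -> E <= k * (2 * c * D + c * E) ->
    E <= 2^-1 * D.
  move=> E0 D0.
  have : 5 * (k * c) * D <= D by rewrite ler_piMl.
  have : 5 * (k * c) * E <= E by rewrite ler_piMl.
  lra.
(* Pays for the factor [d] of [normr_mulmx_le]; the [+ 1] covers [d = 0]. *)
pose c' : R := c / (d%:R + 1).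
have d1 : 0 < d%:R + 1 :> R by rewrite ltr_wpDl.
have c'0 : 0 < c' by rewrite divr_gt0.
have dc' : d%:R * c' <= c.
  rewrite /c' mulrCA -[leRHS]mulr1 ler_wpM2l ?(ltW c0)// ler_pdivrMr// mul1r.
  by rewrite lerDl.
have /nbhs_normP[r /= r0 rP] : \forall x \near a,
    [/\ differentiable F x, 'J F x \in unitmx & `|'J F x - 'J F a| <= c'].
  near=> x; split; near: x => //.
  exact: jacobian_near.
have {}rP x : `|x - a| < r ->
    [/\ differentiable F x, 'J F x \in unitmx &
        forall v : 'rV[R]_d, `|v *m 'J F x - v *m 'J F a| <= c * `|v|].
  rewrite distrC => /rP[dFx uJx Jx]; split=> // v.
  rewrite -mulmxBr (le_trans (normr_mulmx_le _ _ _ _ _ _))//.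
  rewrite mulrCA mulrC; apply: ler_wpM2r => //.
  by apply: le_trans dc'; rewrite ler_wpM2l.
exists r => // x y xr yr.
have [_ uJx Jx] := rP x xr.
have [|_ uJa _] := rP a; first by rewrite subrr normr0.
set e := x - _ - y.
have eJ : e *m 'J F x =
    ((x - y) *m 'J F x - (x - y) *m 'J F a)
    - (F (y + (x - y)) - F y - (x - y) *m 'J F a).
  rewrite /e addrAC mulmxBl (mulmxKV uJx) subrKC.
  by rewrite [in RHS]opprB [RHS]addrA subrK.
have Fxy : `|F (y + (x - y)) - F y - (x - y) *m 'J F a| <= c * `|x - y|.
  apply: mean_value_le => t t01.
    by have [] := rP _ (normr_segment_lt _ _ _ _ _ _ _ xr yr t01).
  have [dFt _ Jt] := rP _ (normr_segment_lt _ _ _ _ _ _ _ xr yr t01).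
  set z := y + t *: (x - y) in dFt Jt *; set v := x - y.
  by have := deriveEjacobian v dFt; rewrite (deriveE v dFt) => ->; exact: Jt.
have eJx : `|e *m 'J F x| <= 2 * c * `|x - y|.
  rewrite eJ; apply: le_trans (ler_normB _ _) _.
  by have := Jx (x - y); lra.
(* [e] is recovered through the inverse at the fixed point [a], so that [k] does not depend on [x];
   exchanging ['J F x] for ['J F a] costs a term [c * |e|], which [arith] absorbs. *)
have ek : `|e| <= k * `|e *m 'J F a|.
  rewrite -{1}[e](mulmxK uJa) (le_trans (normr_mulmx_le _ _ _ _ _ _))//.
  by rewrite /k mulrA mulrAC.
have eJa : `|e *m 'J F a| <= 2 * c * `|x - y| + c * `|e|.
  rewrite -[e *m 'J F a](subKr (e *m 'J F x)).
  by apply: le_trans (ler_normB _ _) _; apply: lerD.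
apply: arith => //; apply: le_trans ek _; exact: ler_wpM2l.
Unshelve. all: by end_near. Qed.

(** * Termination of the Newton method *)

(** The contraction is assumed on the ball only, so the inductive bound also serves to keep each
    iterate inside it. *)
Lemma newton_iter_bound (R : realType) (d : nat) (F : 'rV[R]_d -> 'rV[R]_d)
    (a x : 'rV[R]_d) (r : R) (j : nat) :
  (forall z, `|z - a| < r ->
    `|z - (F z - F a) *m invmx ('J F z) - a| <= 2^-1 * `|z - a|) ->
  `|x - a| < r -> `|newton_iter F (F a) x j - a| <= 2^-1 ^+ j * `|x - a|.
Proof.
move=> ctr xr; elim: j => [|j IH]; first by rewrite expr0 mul1r.
rewrite exprS -mulrA; apply: le_trans (ctr _ _) _.
  apply: le_lt_trans IH _; apply: le_lt_trans xr.
  by rewrite ler_piMl// exprn_ile1// ?invr_ge0// invf_le1 ?ler1n.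
by rewrite ler_wpM2l// invr_ge0.
Qed.

(** The iterates converge to [a], so by continuity some residual falls below [sigma]; the least such
    index is the stopping time, since all earlier residuals are at least [sigma]. *)
Lemma newton_run_exists (R : realType) (d : nat) (U : set 'rV[R]_d)
    (F : 'rV[R]_d -> 'rV[R]_d) (a x : 'rV[R]_d) (r sigma : R) :
  (forall z, `|z - a| < r -> [/\ U z, 'J F z \in unitmx &
    `|z - (F z - F a) *m invmx ('J F z) - a| <= 2^-1 * `|z - a|]) ->
  {for a, continuous F} -> `|x - a| < r -> 0 < sigma ->
  exists x', newton_run U F (F a) sigma x x' /\ `|F x' - F a| < sigma.
Proof.
move=> ctr cF xr s0.
have itb j := @newton_iter_bound _ _ F a x r j
  (fun z zr => let: And3 _ _ h := ctr z zr in h) xr.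
have itr j : `|newton_iter F (F a) x j - a| < r.
  apply: le_lt_trans (itb j) _; apply: le_lt_trans xr.
  by rewrite ler_piMl// exprn_ile1// ?invr_ge0// invf_le1 ?ler1n.
have itcvg : newton_iter F (F a) x @ \oo --> a.
  apply/cvgrPdist_lt => e e0.
  have itb0 : (2^-1 ^+ j * `|x - a| : R) @[j --> \oo] --> (0 : R).
    rewrite -(mul0r `|x - a|); apply: cvgM; last exact: cvg_cst.
    by apply: cvg_expr; rewrite ger0_norm ?invr_ge0// invf_lt1 ?ltr1n.
  have /cvgr0_norm_lt/(_ _ e0) := itb0.
  apply: filterS => j /= je.
  by rewrite distrC (le_lt_trans (itb j))// (le_lt_trans (ler_norm _) je).
have exm : exists m, `|F (newton_iter F (F a) x m) - F a| < sigma.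
  have Fit : F (newton_iter F (F a) x j) @[j --> \oo] --> F a.
    by apply: cvg_comp itcvg _; exact: cF.
  have /cvgrPdist_lt/(_ _ s0)/filter_ex[m] := Fit.
  by rewrite distrC => h; exists m.
case: (ex_minnP exm) => m ms mmin.
exists (newton_iter F (F a) x m); split=> //.
exists m; split=> // [j jm|]; last by have [] := ctr _ (itr m).
have [Uj uJj _] := ctr _ (itr j); split=> //.
by rewrite leNgt; apply: contraL jm => /mmin; rewrite leqNgt.
Qed.

(** * The segment of targets and continuity near it *)

Lemma convex_set_segment (R : realType) (d : nat) (A : set 'rV[R]_d)
    (x y : 'rV[R]_d) (t : R) :
  convex_set A -> A x -> A y -> 0 <= t <= 1 -> A (t *: x + (1 - t) *: y).
Proof.
move=> cA Ax Ay /andP[t0 t1].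
have := cA x y (Itv01 t0 t1) (mem_set Ax) (mem_set Ay).
by rewrite inE.
Qed.

Lemma compact_segment (R : realType) (V : normedModType R) (x y : V) :
  compact ((fun t : R => t *: x + (1 - t) *: y) @` `[0, 1]).
Proof.
apply: continuous_compact; last exact: segment_compact.
apply: continuous_subspaceT => t; apply: cvgD.
  by apply: cvgZr_tmp; exact: cvg_id.
by apply: cvgZr_tmp; apply: cvgB; [exact: cvg_cst|exact: cvg_id].
Qed.

Lemma cont_targetE (R : realType) (d n k : nat) (L0 Ls : 'rV[R]_d) :
  (0 < n)%N -> (k <= n)%N ->
  cont_target n k L0 Ls = (k%:R / n%:R) *: Ls + (1 - k%:R / n%:R) *: L0.
Proof.
move=> n0 kn; rewrite /cont_target scalerDr !scalerA addrC natrB//.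
rewrite [_^-1 * k%:R]mulrC mulrBr mulVf ?pnatr_eq0 -?lt0n//.
by rewrite [_^-1 * k%:R]mulrC.
Qed.

Lemma cont_targetS (R : realType) (d n k : nat) (L0 Ls : 'rV[R]_d) :
  (k < n)%N ->
  cont_target n k.+1 L0 Ls - cont_target n k L0 Ls = n%:R^-1 *: (Ls - L0).
Proof.
move=> kn; rewrite /cont_target -scalerBr; congr (_ *: _).
rewrite !natrB// 1?ltnW// -natr1 !scalerBl !scalerDl !scale1r.
apply/rowP => i; rewrite !mxE; ring.
Qed.

(** Only [x] is confined to [K], while [y] may lie off it: the values of [F] at Newton outputs are
    close to the segment but need not be on it. *)
Lemma uniform_continuous_near (R : realType) (V W : normedModType R)
    (K : set V) (G : V -> W) (e : R) :
  compact K -> (forall x, K x -> {for x, continuous G}) -> 0 < e ->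
  exists2 r, 0 < r & forall x, K x -> forall y, `|y - x| < r ->
    `|G y - G x| < e.
Proof.
move=> cK cG e0.
apply: (compact_uniform_radius _ _ K
  (fun x r => forall y, `|y - x| < r -> `|G y - G x| < e)) => //.
  by move=> x r s sr Pr y ys; apply: Pr; exact: lt_le_trans sr.
move=> x Kx.
have /cvgrPdist_lt/(_ (e / 2)) := cG x Kx.
rewrite divr_gt0// => /(_ erefl)/nbhs_normP[s /= s0 sP].
exists (s / 2); first by rewrite divr_gt0.
move=> y yx z zy; rewrite -(subrKA (G x)).
have yxs : `|G x - G y| < e / 2.
  apply: sP; rewrite /= distrC (lt_le_trans yx)// ler_pdivrMr//.
  by rewrite ler_peMr ?ltW// ltr1n.
have zxs : `|G x - G z| < e / 2.
  apply: sP => /=; rewrite distrC -(subrKA y).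
  by rewrite (le_lt_trans (ler_normD _ _))// [s]splitr ltrD.
rewrite (le_lt_trans (ler_normD _ _))// [e]splitr ltrD//.
by rewrite distrC.
Qed.

(** * The continuation scheme *)

Theorem theorem6p1 (R : realType) (d : nat) (Adom Om : set 'rV[R]_d)
    (F : 'rV[R]_d -> 'rV[R]_d) (Ls L0 As A0 : 'rV[R]_d) :
  open Adom -> connected Adom -> open Om -> convex_set Om ->
  homeo_on Adom Om F -> C2_on Adom F ->
  (forall x, Adom x -> \det ('J F x) != 0) ->
  Om Ls -> Om L0 ->
  Adom As -> F As = Ls ->
  Adom A0 -> F A0 = L0 ->
  forall eps : R, 0 < eps ->
  exists sigma0 : R, exists N0 : nat,
    0 < sigma0 /\ (1 <= N0)%N /\
    forall (n : nat) (sigma : R), (N0 < n)%N -> 0 < sigma -> sigma < sigma0 ->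
      exists Aout, continuation_run Adom F L0 Ls A0 n sigma Aout /\
                   `|Aout - As| < eps.
Proof.
move=> oA _ oO cO [FO _ [G [GO GF cG]]] [dF dDF _] dJ OLs OL0 AAs FAs AA0 FA0.
move=> eps eps0.
pose seg (t : R) : 'rV[R]_d := t *: Ls + (1 - t) *: L0.
pose K := seg @` `[0, 1].
have cK : compact K by exact: compact_segment.
have KO L : K L -> Om L.
  by case=> t /=; rewrite in_itv /= => t01 <-; exact: convex_set_segment.
have cGO L : Om L -> {for L, continuous G}.
  move=> OL; move: cG; rewrite continuous_open_subspace// => /(_ L); apply.
  exact: mem_set.
have cFA x : Adom x -> {for x, continuous F}.
  by move=> /dF; exact: differentiable_continuous.
have [r r0 rP] : exists2 r, 0 < r & forall L, K L -> forall z, `|z - G L| < r ->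
    [/\ Adom z, 'J F z \in unitmx &
      `|z - (F z - F (G L)) *m invmx ('J F z) - G L| <= 2^-1 * `|z - G L|].
  apply: (compact_uniform_radius _ _ K (fun L r => forall z, `|z - G L| < r ->
    [/\ Adom z, 'J F z \in unitmx & `|z - (F z - F (G L)) *m invmx ('J F z)
      - G L| <= 2^-1 * `|z - G L|])) => //.
    by move=> L r s sr Pr z zs; apply: Pr; exact: lt_le_trans sr.
  move=> L /KO OL; have [AGL _] := GO L OL.
  have nA : \forall x \near G L, Adom x by exact: open_nbhs_nbhs.
  have [|i||s s0 sP] := newton_step_near _ _ F (G L).
  - exact: filterS nA.
  - exact/differentiable_continuous/dDF.
  - by apply: filterS nA => x /dJ; rewrite unitmxE unitfE.
  have /nbhs_normP[q /= q0 qA] := nA.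
  (* A point within [p] of [G L'], itself within [p] of [G L], is within [2 * p] of [G L], hence in
     both the contraction ball and the domain. *)
  pose p := Num.min (s / 2) (q / 2).
  have p0 : 0 < p by rewrite lt_min !divr_gt0.
  have ps : p <= s / 2 by rewrite ge_min lexx.
  have pq : p <= q / 2 by rewrite ge_min lexx orbT.
  have /cvgrPdist_lt/(_ _ p0)/nbhs_normP[u /= u0 uP] := cGO L OL.
  (* One radius plays two roles: [u] limits the distance from [L'] to [L], and [p] that from [z] to
     [G L']. *)
  exists (Num.min u p); first by rewrite lt_min u0.
  move=> L'; rewrite lt_min => /andP[L'u _] z; rewrite lt_min => /andP[_ zp].
  have GL' : `|G L' - G L| < p by rewrite distrC; apply: uP; rewrite /= distrC.
  have zL : `|z - G L| < p + p.
    by rewrite -(subrKA (G L')) (le_lt_trans (ler_normD _ _))// ltrD.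
  have Az : Adom z.
    by apply: qA; rewrite /= distrC (lt_le_trans zL)// [leRHS]splitr lerD.
  split=> //; first by rewrite unitmxE unitfE; exact: dJ.
  apply: sP; first by rewrite (lt_le_trans zL)// [leRHS]splitr lerD.
  rewrite (lt_le_trans GL')// (le_trans ps)// ler_pdivrMr//.
  by rewrite ler_peMr ?ltW// ltr1n.
(* The error of one output and the move to the next exact solution add up, hence [r / 2]; [eps]
   serves the final estimate. *)
pose rho := Num.min (r / 2) eps.
have rho0 : 0 < rho by rewrite lt_min divr_gt0.
have rhor : rho + rho <= r by rewrite [leRHS]splitr lerD// ge_min lexx.
have rhoe : rho <= eps by rewrite ge_min lexx orbT.
have [del del0 delP] := uniform_continuous_near _ _ _ K G rho cK
  (fun L KL => cGO L (KO L KL)) rho0.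
(* [del] bounds both the tolerance and the spacing [|Ls - L0| / n] of the targets, the latter once
   [n] exceeds [|Ls - L0| / del]. *)
exists del, (Num.truncn (`|Ls - L0| / del)).+1; split=> //; split=> //.
move=> n sigma Nn s0 sdel.
have n0 : (0 < n)%N by apply: leq_ltn_trans Nn.
pose T k := cont_target n k L0 Ls.
have KT k : (k <= n)%N -> K (T k).
  move=> kn; exists (k%:R / n%:R); last by rewrite /T cont_targetE.
  by rewrite /= in_itv/= divr_ge0//= ler_pdivrMr ?ltr0n// mul1r ler_nat.
have T0 : T 0%N = L0.
  by rewrite /T cont_targetE// mul0r scale0r subr0 scale1r add0r.
have Tn : T n = Ls.
  rewrite /T cont_targetE// divff ?pnatr_eq0 -?lt0n//.
  by rewrite subrr scale0r scale1r addr0.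
have dT k : (k < n)%N -> `|T k - T k.+1| < del.
  move=> kn; rewrite distrC cont_targetS// normrZ ger0_norm ?invr_ge0//.
  rewrite mulrC ltr_pdivrMr ?ltr0n// mulrC -ltr_pdivrMr//.
  by apply: lt_le_trans (truncnS_gt _) _; rewrite ler_nat ltnW.
(* The conditions stand under the existential so that [choice] yields a total function; where they
   fail, [0] is an arbitrary value. *)
have step (kx : nat * 'rV[R]_d) : exists x', (kx.1 < n)%N ->
    `|kx.2 - G (T kx.1)| < rho ->
    newton_run Adom F (T kx.1.+1) sigma kx.2 x' /\ `|x' - G (T kx.1.+1)| < rho.
  case: kx => k x /=.
  have [kn|] := boolP (k < n)%N; last by exists 0.
  have [xk|] := boolP (`|x - G (T k)| < rho); last by exists 0.
  have KTS := KT _ kn; have [AG FG] := GO _ (KO _ KTS).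
  have xr : `|x - G (T k.+1)| < r.
    apply: lt_le_trans rhor; rewrite -(subrKA (G (T k))).
    by rewrite (le_lt_trans (ler_normD _ _))// ltrD// delP// dT.
  have [x' []] := newton_run_exists _ _ Adom F _ x r sigma (rP _ KTS) (cFA _ AG)
    xr s0.
  rewrite FG => run x's; exists x' => _ _; split=> //.
  have Ax' : Adom x' by case: run => m [_ Am _ ->].
  (* The residual controls the error: [x' = G (F x')], and [F x'] is within [sigma < del] of the
     target. *)
  by rewrite -(GF x' Ax') delP// (lt_trans x's).
have [f fP] := choice step.
pose Afin := nat_rect (fun=> 'rV[R]_d) A0 (fun k x => f (k, x)).
have inv k : (k <= n)%N -> `|Afin k - G (T k)| < rho.
  elim: k => [_|k IH kn]; first by rewrite /= T0 -FA0 GF// subrr normr0.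
  by have [] := fP (k, Afin k) kn (IH (ltnW kn)).
exists (Afin n); split; last first.
  by rewrite -(GF As AAs) FAs -Tn (lt_le_trans (inv n (leqnn n))).
exists Afin; split=> // -[//|k] /= kn.
by have [] := fP (k, Afin k) kn (inv k (ltnW kn)).
Qed.
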